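(* Let $m\ge r\ge 0$ be integers and let $(\varphi_1,\ldots,\varphi_m)$ be a partition of $r$, i.e. a tuple of non-negative integers with $\sum_{i=1}^m i\,\varphi_i=r$. Then $$\sum_{\substack{(y_1,\ldots,y_m)\\ \sum i y_i=m}}\prod_{i=1}^{m}\frac{(-1)^{y_i}\binom{y_i}{\varphi_i}}{i^{y_i}\,y_i!}=\sum_{\substack{(y_1,\ldots,y_m)\\ \sum i y_i=m\\ y_i\ge\varphi_i\ \forall i}}\prod_{i=1}^{m}\frac{(-1)^{y_i}\binom{y_i}{\varphi_i}}{i^{y_i}\,y_i!}=\begin{cases}(-1)^{m-r}\displaystyle\prod_{i=1}^{m}\frac{(-1)^{\varphi_i}}{i^{\varphi_i}\,\varphi_i!} & \text{for } 0\le m-r\le 1,\\ 0 & \text{for } m-r\ge 2,\end{cases}$$ where the first sum runs over all partitions of $m$ and the second over those with $y_i\ge\varphi_i$ for every $i$.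
   Context: A partition of $m$ is represented by the tuple $(y_1,\ldots,y_m)$ of non-negative integers with $\sum_{i=1}^m i\,y_i=m$. For $m=0$ there is exactly one partition, the empty one. Empty products equal $1$, and $\binom{a}{b}=0$ for integers $0\le a<b$. *)

(* Defs.v *)
From mathcomp Require Import all_boot all_order all_algebra.

Set Implicit Arguments.
Unset Strict Implicit.
Unset Printing Implicit Defensive.

Import GRing.Theory.
Local Open Scope ring_scope.

(* Ordinals start at 0, so the tuple (y_1, ..., y_m) is a function on 'I_m
   whose value at i is the multiplicity of the part i.+1. *)
Definition is_partition (m n : nat) (y : 'I_m -> nat) : bool :=
  (\sum_(i < m) i.+1 * y i == n)%N.

(* Multiplicities in a partition of m are at most m, so restricting the values
   to 'I_m.+1 turns the tuples into a finite type without losing any. *)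
Definition mult_tuple (m : nat) : finType := {ffun 'I_m -> 'I_m.+1}.

Definition mults (m : nat) (y : mult_tuple m) : 'I_m -> nat :=
  fun i => val (y i).

Lemma mults_surj (m : nat) (y : 'I_m -> nat) :
  is_partition m y -> exists z : mult_tuple m, mults z =1 y.
Proof.
move=> /eqP ym.
have le_ym i : (y i <= m)%N.
  rewrite -[X in (_ <= X)%N]ym (bigD1 i) //= mulSn -addnA.
  exact: leq_addr.
exists [ffun i => inord (y i)] => i.
by rewrite /mults ffunE /= inordK ?ltnS.
Qed.

Lemma mults_inj (m : nat) (y z : mult_tuple m) : mults y =1 mults z -> y = z.
Proof. by move=> yz; apply/ffunP => i; apply: val_inj; apply: yz. Qed.

Definition weight (m : nat) (phi y : 'I_m -> nat) : rat :=
  \prod_(i < m)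
    ((-1) ^+ y i * 'C(y i, phi i)%:R / (i.+1%:R ^+ y i * (y i)`!%:R)).

(* Main.v *)
Require Import Defs.
From mathcomp Require Import all_boot all_order all_algebra.
From mathcomp Require Import ring.

Set Implicit Arguments.
Unset Strict Implicit.
Unset Printing Implicit Defensive.

Import GRing.Theory Num.Theory.
Local Open Scope ring_scope.

(** The sum in question is a coefficient of exp(- sum_i x^i / i) = 1 - x, taken
    after the factor indexed by phi has been split off.

    Write mono y for the product of (-1)^(y_i) / (i^(y_i) y_i!).  Cancelling
    factorials gives weight phi (z + phi) = mono phi * mono z, and the terms
    where phi <= y fails vanish, so the substitution y = z + phi shows that
    weight phi sums to mono phi * c_(m - r), where c_n is the sum of mono over
    the partitions of n (lemma sum_weight).

    The coefficients c_n can be computed without power series, by using the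
    same lemma a second time.  For the partition e_i consisting of the single
    part i, weight e_i y = y_i mono y and mono e_i = - 1 / i, so the identity
    n = sum_i i y_i, multiplied by mono y and summed over the partitions y of
    n, becomes n c_n = - (c_0 + ... + c_(n-1)).  This is the logarithmic
    derivative of the generating function, read coefficientwise.  Starting
    from c_0 = 1 it yields c_1 = -1, after which all partial sums vanish, and
    with them all further c_n. *)

Section PartitionSums.
Variable m : nat.
Implicit Types (n r : nat) (i : 'I_m) (phi z : 'I_m -> nat).

(** * Shifting a partition by another one *)

Lemma leq_part n z i : is_partition n z -> (i.+1 * z i <= n)%N.
Proof. by move=> /eqP <-; rewrite (bigD1 i) //= leq_addr. Qed.

Lemma leq_mult n z i : is_partition n z -> (z i <= n)%N.
Proof. by move=> /(leq_part i); apply: leq_trans; rewrite leq_pmull. Qed.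

Lemma eq_is_partition n z z' : z =1 z' -> is_partition n z = is_partition n z'.
Proof. by move=> zz'; congr (_ == _); apply: eq_bigr => i _; rewrite zz'. Qed.

Lemma is_partitionD n r phi z : is_partition r phi ->
  is_partition (n + r) (fun i => z i + phi i)%N = is_partition n z.
Proof.
move=> /eqP phir; rewrite /is_partition.
under eq_bigr do rewrite mulnDr.
by rewrite big_split /= phir eqn_add2r.
Qed.

(** The bound on multiplicities makes shift wrap around when z_i + phi_i > m;
    this cannot happen when z + phi is a partition of a number at most m. *)
Definition shift phi (z : mult_tuple m) : mult_tuple m :=
  [ffun i => inord (z i + phi i)%N].

Definition unshift phi (y : mult_tuple m) : mult_tuple m :=
  [ffun i => inord (y i - phi i)%N].

Lemma mults_unshift phi (y : mult_tuple m) i : mults (unshift phi y) i = (mults y i - phi i)%N.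
Proof.
rewrite /mults ffunE /= inordK // ltnS.
by apply: leq_trans (leq_subr _ _) _; rewrite -ltnS.
Qed.

Lemma mults_shift phi (z : mult_tuple m) i :
  (mults z i + phi i <= m)%N -> mults (shift phi z) i = (mults z i + phi i)%N.
Proof. by move=> le_m; rewrite /mults ffunE /= inordK. Qed.

(** The truncated difference gives (y_i - phi_i) + phi_i = max(y_i, phi_i), which
    is y_i exactly when phi_i <= y_i. *)
Lemma unshiftK phi (y : mult_tuple m) : (forall i, phi i <= m)%N ->
  (shift phi (unshift phi y) == y) = [forall i, (phi i <= mults y i)%N].
Proof.
move=> phim.
have shiftE i :
    mults (shift phi (unshift phi y)) i = (mults y i - phi i + phi i)%N.
  rewrite mults_shift mults_unshift //.
  by rewrite addnC -maxnE geq_max phim -ltnS ltn_ord.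
apply/eqP/forallP => [yE i | le_phi].
  by rewrite -[in X in (_ <= X)%N]yE shiftE leq_addl.
by apply: mults_inj => i; rewrite shiftE subnK.
Qed.

Lemma sum_partition_shift n r phi (F : mult_tuple m -> rat) :
    (n + r <= m)%N -> is_partition r phi ->
  \sum_(y : mult_tuple m | is_partition (n + r) (mults y)
                           && [forall i, (phi i <= mults y i)%N])
     F (unshift phi y)
  = \sum_(z : mult_tuple m | is_partition n (mults z)) F z.
Proof.
move=> le_m phir.
rewrite [RHS](reindex_onto (unshift phi) (shift phi)) /=; last first.
  move=> z zn; apply: mults_inj => i.
  rewrite mults_unshift mults_shift ?addnK //.
  apply: leq_trans le_m.
  by rewrite -(is_partitionD n _ phir) in zn; exact: (leq_mult i zn).
apply: eq_bigl => y; rewrite unshiftK; last first.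
  by move=> i; rewrite (leq_trans (leq_mult i phir)) // (leq_trans _ le_m) ?leq_addl.
case: forallP => [le_phi | _]; last by rewrite !andbF.
rewrite !andbT -(is_partitionD n _ phir); apply: eq_is_partition => i.
by rewrite mults_unshift subnK.
Qed.

(** * Splitting off the factor of phi *)

Definition mono z : rat :=
  \prod_(i < m) ((-1) ^+ z i / (i.+1%:R ^+ z i * (z i)`!%:R)).

Lemma weight_eq0 phi z : ~~ [forall i, (phi i <= z i)%N] -> weight phi z = 0.
Proof.
move=> /forallPn[i]; rewrite -ltnNge => lt_phi.
by rewrite /weight (bigD1 i) //= bin_small // mulr0 !mul0r.
Qed.

(** Factor by factor: writing y = z + phi, the binomial coefficient is
    y! / (z! phi!), which cancels the denominator y!, and the powers of -1 and of
    the part split along the sum z + phi. *)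
Lemma weight_shift phi z : (forall i, phi i <= z i)%N ->
  weight phi z = mono phi * mono (fun i => z i - phi i)%N.
Proof.
move=> le_phi; rewrite /weight /mono -big_split; apply: eq_bigr => i _ /=.
rewrite -[in LHS](subnK (le_phi i)); set a := (z i - phi i)%N; set b := phi i.
have b_le : (b <= a + b)%N by rewrite leq_addl.
rewrite -(bin_fact b_le) addnK !exprD !natrM.
have fact0 k : k`!%:R != 0 :> rat by rewrite pnatr_eq0 -lt0n fact_gt0.
have bin0 : 'C(a + b, b)%:R != 0 :> rat by rewrite pnatr_eq0 -lt0n bin_gt0.
have pow0 k : i.+1%:R ^+ k != 0 :> rat by rewrite expf_neq0 // pnatr_eq0.
by field; rewrite !fact0 bin0 !pow0.
Qed.

Lemma eq_mono z z' : z =1 z' -> mono z = mono z'.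
Proof. by move=> zz'; apply: eq_bigr => i _; rewrite zz'. Qed.

Definition mono_sum n : rat :=
  \sum_(z : mult_tuple m | is_partition n (mults z)) mono (mults z).

Lemma sum_weight_geq n phi :
  \sum_(y : mult_tuple m | is_partition n (mults y)) weight phi (mults y)
  = \sum_(y : mult_tuple m | is_partition n (mults y)
                             && [forall i, (phi i <= mults y i)%N])
      weight phi (mults y).
Proof.
rewrite [LHS](bigID (fun y => [forall i, (phi i <= mults y i)%N])) /=.
by rewrite [X in _ + X]big1 ?addr0 // => y /andP[_ /weight_eq0].
Qed.

(** The common source of the two results below: the general phi gives the
    theorem, and the partitions with a single part give the recurrence for
    mono_sum. *)
Lemma sum_weight n r phi : (n + r <= m)%N -> is_partition r phi ->
  \sum_(y : mult_tuple m | is_partition (n + r) (mults y)) weight phi (mults y)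
  = mono phi * mono_sum n.
Proof.
move=> le_m phir; rewrite sum_weight_geq.
rewrite /mono_sum -(sum_partition_shift _ le_m phir) mulr_sumr.
apply: eq_bigr => y /andP[_ /forallP le_phi].
by rewrite weight_shift //; congr (_ * _); apply: eq_mono => i; rewrite mults_unshift.
Qed.

(** * The sum of mono over the partitions of n *)

Definition single (i j : 'I_m) : nat := (j == i).

Lemma is_partition_single i : is_partition i.+1 (single i).
Proof.
rewrite /is_partition (bigD1 i) //= /single eqxx muln1 big1 ?addn0 //.
by move=> j /negPf ->; rewrite muln0.
Qed.

Lemma mono_single i : mono (single i) = - i.+1%:R^-1.
Proof.
rewrite /mono (bigD1 i) //= /single eqxx !expr1 big1 => [|j /negPf ->].
  by rewrite !mulr1 mulN1r.
by rewrite !expr0 mul1r fact0 divr1.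
Qed.

Lemma weight_single i z : weight (single i) z = (z i)%:R * mono z.
Proof.
rewrite /weight /mono (bigD1 i) //= [in RHS](bigD1 i) //= /single eqxx bin1.
rewrite mulrA [(-1) ^+ _ * _]mulrC !mulrA; congr (_ * _).
by apply: eq_bigr => j /negPf ->; rewrite bin0 mulr1.
Qed.

(** Up to the factor i + 1 this is the sum of weight (single i), hence a multiple
    of mono_sum (n - (i + 1)); the factor i + 1 cancels against mono (single i).
    When the part i + 1 exceeds n, it has multiplicity 0. *)
Lemma sum_mult_mono n (i : 'I_m) : (n <= m)%N ->
  \sum_(z : mult_tuple m | is_partition n (mults z))
     (i.+1 * mults z i)%:R * mono (mults z)
  = if (i < n)%N then - mono_sum (n - i.+1) else 0.
Proof.
move=> le_m; case: ltnP => [lt_in | le_ni]; last first.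
  rewrite big1 // => z /(leq_part i) le_n.
  have /eqP -> : mults z i == 0%N.
    by rewrite -leqn0 -ltnS -(ltn_pmul2l (ltn0Sn i)) muln1 ltnS (leq_trans le_n).
  by rewrite muln0 mul0r.
under eq_bigr do rewrite natrM -mulrA -weight_single.
rewrite -mulr_sumr -{1}(subnK lt_in) (@sum_weight _ i.+1) ?subnK //; last first.
  exact: is_partition_single.
by rewrite mono_single mulNr mulrN mulrA divff ?mul1r ?pnatr_eq0.
Qed.

(** The logarithmic derivative of the generating function of mono_sum: the
    total n = sum_i i z_i of a partition z, weighted by mono z, is evaluated
    one part size at a time. *)
Lemma mono_sum_rec n : (n <= m)%N ->
  n%:R * mono_sum n = - \sum_(k < n) mono_sum k.
Proof.
move=> le_m.
have -> : n%:R * mono_sum n = \sum_(i < m)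
    \sum_(z : mult_tuple m | is_partition n (mults z))
       (i.+1 * mults z i)%:R * mono (mults z).
  (* Each partition z of n contributes (sum_i i z_i) mono z = n mono z. *)
  rewrite exchange_big mulr_sumr; apply: eq_bigr => z /eqP zn.
  by rewrite -mulr_suml -natr_sum zn.
under eq_bigr do rewrite sum_mult_mono //.
rewrite -big_mkcond (big_ord_narrow le_m) sumrN; congr (- _).
by rewrite (reindex_inj rev_ord_inj) /=; apply: eq_bigr => k _; rewrite subnSK // subKn // ltnW.
Qed.

Lemma mono_sum0 : mono_sum 0 = 1.
Proof.
pose z0 : mult_tuple m := [ffun=> ord0].
have z0E i : mults z0 i = 0%N by rewrite /mults ffunE.
rewrite /mono_sum (big_pred1 z0) => [|z /=].
  by rewrite /mono big1 // => i _; rewrite z0E !expr0 mul1r fact0 divr1.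
apply/idP/eqP => [zn | ->].
  by apply: mults_inj => i; apply/eqP; rewrite z0E -leqn0 (leq_mult i zn).
by rewrite /is_partition big1 // => i _; rewrite z0E muln0.
Qed.

(** Partial sums are the coefficients of (1 - x) / (1 - x) = 1.  If the sum up
    to n is s_n, the recurrence reads s_(n+1) = (1 - 1/(n+1)) s_n, and the
    factor 0 at n = 0 annihilates everything that follows. *)
Lemma sum_mono_sum n : (n <= m)%N -> \sum_(k < n.+1) mono_sum k = (n == 0)%:R.
Proof.
elim: n => [|n IHn] le_m; first by rewrite big_ord1 mono_sum0.
rewrite big_ord_recr /=; have := mono_sum_rec le_m.
rewrite IHn ?(ltnW le_m) //.
case: n {IHn} le_m => [|n] le_m; first by rewrite mul1r => ->; rewrite subrr.
by rewrite oppr0 add0r => /eqP; rewrite mulf_eq0 pnatr_eq0 => /eqP.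
Qed.

Lemma mono_sumE n : (n <= m)%N ->
  mono_sum n = if (n <= 1)%N then (-1) ^+ n else 0.
Proof.
case: n => [|n] le_m; first by rewrite mono_sum0.
have := mono_sum_rec le_m; rewrite sum_mono_sum ?(ltnW le_m) //.
case: n le_m => [|n] le_m; first by rewrite mul1r => ->.
by rewrite oppr0 => /eqP; rewrite mulf_eq0 pnatr_eq0 => /eqP.
Qed.

End PartitionSums.

Theorem lemma3p2 (m r : nat) (phi : 'I_m -> nat)
    (hrm : (r <= m)%N) (hphi : is_partition r phi) :
  \sum_(y : mult_tuple m | is_partition m (mults y)) weight phi (mults y)
  = \sum_(y : mult_tuple m | is_partition m (mults y)
                             && [forall i, (phi i <= mults y i)%N])
      weight phi (mults y)
  /\
  \sum_(y : mult_tuple m | is_partition m (mults y)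
                           && [forall i, (phi i <= mults y i)%N])
      weight phi (mults y)
  = if (m - r <= 1)%N
    then (-1) ^+ (m - r)
         * \prod_(i < m) ((-1) ^+ phi i / (i.+1%:R ^+ phi i * (phi i)`!%:R))
    else 0.
Proof.
split; first exact: sum_weight_geq.
have := @sum_weight m (m - r) r phi.
rewrite subnK // -sum_weight_geq => /(_ (leqnn m) hphi) ->.
rewrite mono_sumE ?leq_subr //.
by case: ifP => _; rewrite ?mulr0 // mulrC.
Qed.
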